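(* Let $y\in\mathbb{R}$, $q\in(0,1)$, $\lambda>0$, and let $h:\mathbb{R}\to\mathbb{R}$ be given by $h(x)=(y-x)^2+\lambda|x|^q$. Set \[ a=\frac{2-q}{2}\,(1-q)^{\frac{q-1}{2-q}}\,\lambda^{\frac{1}{2-q}} . \] Then $h$ attains its (global) minimum over $\mathbb{R}$ at the point \[ \psi_H(y;\lambda):=\begin{cases} x', & \text{if } |y|>a,\\ 0, & \text{if } |y|\le a,\end{cases} \] where, for $|y|>a$, $x'$ is the solution of largest absolute value of $h'(x)=0$ on the open interval $(\min\{0,y\},\max\{0,y\})$. In particular, \[ |x'|>\left(\frac{\lambda q(1-q)}{2}\right)^{\frac{1}{2-q}} . \]
   Context: Here $h'$ denotes the derivative of $h$, which exists at every $x\neq 0$; in particular it exists on the open interval $(\min\{0,y\},\max\{0,y\})$. *)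

(* Defs.v *)
From HB Require Import structures.
From mathcomp Require Import all_boot all_order all_algebra.
From mathcomp Require Import all_classical all_reals all_analysis.

Set Implicit Arguments.
Unset Strict Implicit.
Unset Printing Implicit Defensive.

Import Order.TTheory GRing.Theory Num.Theory.
Import numFieldNormedType.Exports.

Local Open Scope classical_set_scope.
Local Open Scope ring_scope.

(* Since 0 `^ q = 0 for q != 0, the penalty vanishes at x = 0. *)
Definition objective (R : realType) (q lam y : R) (x : R) : R :=
  (y - x) ^+ 2 + lam * `|x| `^ q.

Definition threshold (R : realType) (q lam : R) : R :=
  (2 - q) / 2 * (1 - q) `^ ((q - 1) / (2 - q)) * lam `^ (1 / (2 - q)).

(* The interval does not contain 0, so the objective is differentiable on it
   and the total operator derive1 takes no junk value here. *)
Definition critical_points (R : realType) (q lam y : R) : set R :=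
  [set x : R | (x \in `]Num.min 0 y, Num.max 0 y[) /\
           derive1 (objective q lam y) x = 0].

Definition largest_critical (R : realType) (q lam y x : R) : Prop :=
  critical_points q lam y x /\
  (forall z : R, critical_points q lam y z -> `|z| <= `|x|).

(* The value 0 is a default, used only if no such point exists. *)
Definition xprime (R : realType) (q lam y : R) : R :=
  xget 0 [set x | largest_critical q lam y x].

Definition psi_H (R : realType) (q lam y : R) : R :=
  if threshold q lam < `|y| then xprime q lam y else 0.

(* Main.v *)
(* Multiplying h'(x) = 0 by x > 0 turns it into 2x(x - y) + q lam x^q = 0. Let
   m = (lam (1 - q))^(1/(2-q)), so that lam (1 - q) m^q = m^2 and the threshold
   is a = (2 - q) m / (2 (1 - q)). For y > a the equation has a root x' in
   (m, y) by the intermediate value theorem. Every comparison reduces to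
   Bernoulli's inequality (2 - q) t <= (1 - q) t^2 + t^q by scaling: z = t m for
   h(0) <= h(z) when |y| <= a, and z = t x' for h'(z) > 0 beyond x' and for
   h(x') <= h(z). Negative y follow by the symmetry (y, x) -> (-y, -x). *)
Require Import Defs.
From HB Require Import structures.
From mathcomp Require Import all_boot all_order all_algebra.
From mathcomp Require Import all_classical all_reals all_analysis.
From mathcomp Require Import ring lra.

Set Implicit Arguments.
Unset Strict Implicit.
Unset Printing Implicit Defensive.

Import Order.TTheory GRing.Theory Num.Theory.
Import numFieldNormedType.Exports.

Local Open Scope classical_set_scope.
Local Open Scope ring_scope.

(** * Bernoulli's inequality, the pivot and the threshold *)

(** For t > 0, divide by t and write t^(q-1) as exp((q-1) ln t). Then exp s >= 1 + s and ln t <= t -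
    1 suffice, the sign of q - 1 reversing the second bound. *)
Lemma powR_bernoulli (R : realType) (q t : R) :
  0 < q -> q < 1 -> 0 <= t ->
  (2 - q) * t <= (1 - q) * t ^+ 2 + t `^ q.
Proof.
move=> q0 q1; rewrite le_eqVlt => /predU1P[<-|t0].
  by rewrite powR0 ?gt_eqF//; lra.
have lnt : ln t <= t - 1 by rewrite -[in ln t](subrKC 1 t) le_ln1Dx//; lra.
have lb : 2 - q - (1 - q) * t <= t `^ (q - 1).
  rewrite /powR gt_eqF//; apply: le_trans (expR_ge1Dx _).
  by nra.
have := mulr_powRB1 (ltW t0) q0.
by nra.
Qed.

(* The minimizer over x > 0 of x + lam x^(q-1), whose minimum is twice the
   threshold. *)
Definition pivot (R : realType) (q lam : R) : R :=
  (lam * (1 - q)) `^ (1 / (2 - q)).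

Lemma pivot_gt0 (R : realType) (q lam : R) :
  q < 1 -> 0 < lam -> 0 < pivot q lam.
Proof. by move=> q1 l0; apply: powR_gt0; nra. Qed.

Lemma pivot_powR (R : realType) (q lam : R) :
  q < 1 -> 0 < lam ->
  lam * (1 - q) * pivot q lam `^ q = pivot q lam ^+ 2.
Proof.
move=> q1 l0; have m0 := pivot_gt0 q1 l0.
have lq0 : 0 < lam * (1 - q) by nra.
have <- : pivot q lam `^ (2 - q) = lam * (1 - q).
  by rewrite -powRrM div1r mulVf ?powRr1 ?(ltW lq0)// gt_eqF//; lra.
rewrite -powRD; last by rewrite (gt_eqF m0) implybT.
by rewrite subrK; exact: (powR_mulrn 2 (ltW m0)).
Qed.

Lemma thresholdE (R : realType) (q lam : R) :
  q < 1 -> 0 < lam ->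
  2 * (1 - q) * threshold q lam = (2 - q) * pivot q lam.
Proof.
move=> q1 l0; rewrite /threshold /pivot powRM ?(ltW l0)//; last by lra.
(* This exponent is one less than that of the pivot, so the two sides differ only by a factor 1 -
   q. *)
have -> : (q - 1) / (2 - q) = 1 / (2 - q) - 1.
  by field; apply/negP => /eqP; lra.
have q1' : 0 < 1 - q by lra.
rewrite powRB ?(gt_eqF q1') ?implybT// powRr1; last exact: ltW.
by field; rewrite gt_eqF.
Qed.

Lemma threshold_gt0 (R : realType) (q lam : R) :
  q < 1 -> 0 < lam -> 0 < threshold q lam.
Proof.
move=> q1 l0; have := thresholdE q1 l0; have := pivot_gt0 q1 l0.
by nra.
Qed.

(** At x = m there is equality. Writing x = t m with t > 1 reduces the claim to t^q <= t < t^2. *)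
Lemma pivot_lt_powR (R : realType) (q lam x : R) :
  q < 1 -> 0 < lam -> pivot q lam < x ->
  lam * (1 - q) * x `^ q < x ^+ 2.
Proof.
move=> q1 l0 mx; have m0 := pivot_gt0 q1 l0; have := pivot_powR q1 l0.
move: mx m0; set m := pivot q lam => mx m0 mE.
have t1 : 1 < x / m by rewrite ltr_pdivlMr// mul1r.
have -> : x = x / m * m by rewrite divfK ?gt_eqF.
move: (x / m) t1 => t t1; rewrite powRM//; [|lra|lra].
rewrite mulrCA mE exprMn mulrC [ltRHS]mulrC ltr_pM2l ?exprn_gt0//.
by rewrite (le_lt_trans (ler1_powR _ _))//; [lra|lra|nra].
Qed.

(** * Small |y|: the minimum at 0 *)

Lemma objectiveNN (R : realType) (q lam y x : R) :
  objective q lam (- y) (- x) = objective q lam y x.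
Proof. by rewrite /objective normrN; ring. Qed.

Lemma le_objective_norm (R : realType) (q lam y x : R) :
  0 <= y -> objective q lam y `|x| <= objective q lam y x.
Proof.
move=> y0; rewrite /objective normr_id lerD2r.
by have := normr_ge0 x; have := ler_norm x; have := real_normK (num_real x); nra.
Qed.

(** Bernoulli's inequality at t = x / m, multiplied by m^2. It yields h(z) - h(0) >= 2 (a - y) z for
    z >= 0. *)
Lemma threshold_le (R : realType) (q lam x : R) :
  0 < q -> q < 1 -> 0 < lam -> 0 <= x ->
  2 * threshold q lam * x <= x ^+ 2 + lam * x `^ q.
Proof.
move=> q0 q1 l0 x0; have m0 := pivot_gt0 q1 l0.
have := pivot_powR q1 l0; have := thresholdE q1 l0.
move: m0; set m := pivot q lam; set a := threshold _ _ => m0 aE mE.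
have t0 : 0 <= x / m by rewrite divr_ge0// ltW.
have -> : x = x / m * m by rewrite divfK ?gt_eqF.
move: (x / m) t0 => t t0; rewrite powRM//; last by lra.
have := powR_bernoulli q0 q1 t0.
rewrite -(ler_pM2l (exprn_gt0 2 m0)) => B.
have q1' : 0 < 1 - q by lra.
rewrite -(ler_pM2l q1').
have -> : (1 - q) * (2 * a * (t * m)) = m ^+ 2 * ((2 - q) * t).
  by transitivity (2 * (1 - q) * a * (t * m)); [ring|rewrite aE; ring].
apply: le_trans B _; rewrite le_eqVlt; apply/orP; left; apply/eqP.
(* Only the m^2 in front of t^q becomes lam (1 - q) m^q; the other one is absorbed in (t m)^2. *)
rewrite mulrDr -{2}mE; ring.
Qed.

Lemma objective_le0_threshold (R : realType) (q lam y x : R) :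
  0 < q -> q < 1 -> 0 < lam -> `|y| <= threshold q lam ->
  objective q lam y 0 <= objective q lam y x.
Proof.
move=> q0 q1 l0; wlog y0 : y x / 0 <= y => [H|].
  have [y0|/ltW y0] := leP 0 y; first exact: H.
  rewrite -normrN => ya; rewrite -objectiveNN oppr0 -[leRHS]objectiveNN.
  by apply: H; rewrite ?oppr_ge0.
rewrite ger0_norm// => ya; apply: le_trans (le_objective_norm _ _ _ y0).
have x0 := normr_ge0 x; have := threshold_le q0 q1 l0 x0.
rewrite /objective normr_id normr0 powR0 ?gt_eqF//; move: (`|x|) x0 => z z0.
by move: (z `^ q) => w; nra.
Qed.

(** * Critical points and the reflection symmetry *)

Lemma is_derive_objective (R : realType) (q lam y x : R) : 0 < x ->
  is_derive x 1 (objective q lam y) (2 * (x - y) + lam * (q * x `^ (q - 1))).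
Proof.
move=> x0.
apply: (@near_eq_is_derive _ _ _ (fun z => (y - z) ^+ 2 + lam * z `^ q)).
  near=> z; rewrite /objective gtr0_norm//.
  by near: z; exact: lt_nbhsr.
have D := is_derive1_powR q x0.
have E : is_derive x 1 (fun z : R => y - z) (-1).
  by apply: is_derive_eq; rewrite add0r mul1r.
have F := is_deriveX 2 E.
have G := is_deriveZ lam D.
apply: is_derive_eq (is_deriveD F G) _.
rewrite /GRing.scale /=; ring.
Unshelve. all: by end_near. Qed.

Lemma critical_pointsP (R : realType) (q lam y x : R) : 0 < q -> 0 < y ->
  critical_points q lam y x <->
  0 < x < y /\ 2 * x * (x - y) + q * lam * x `^ q = 0.
Proof.
move=> q0 y0; rewrite /critical_points /= (min_l (ltW y0)) (max_r (ltW y0)).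
rewrite in_itv /=; split=> -[/andP[x0 xy]] E; (split; first exact/andP);
  have [_ D] := is_derive_objective q lam y x0;
  have P := mulr_powRB1 (ltW x0) q0.
  by move: E; rewrite derive1E D -P => E; rewrite -(mulr0 x) -E; ring.
rewrite derive1E D; apply: (mulfI (lt0r_neq0 x0)); rewrite mulr0 -E -P; ring.
Qed.

Lemma critical_pointsN (R : realType) (q lam y x : R) : 0 < y ->
  critical_points q lam (- y) (- x) <-> critical_points q lam y x.
Proof.
move=> y0; rewrite /critical_points /= (min_l (ltW y0)) (max_r (ltW y0)).
have yn : - y <= 0 by rewrite oppr_le0 ltW.
rewrite (min_r yn) (max_l yn) !in_itv /= ltrN2 oppr_lt0 andbC.
have fE : objective q lam (- y) = objective q lam y \o -%R.
  by apply/funext => z /=; rewrite -objectiveNN opprK.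
(* Both intervals force x > 0, so the derivatives are compared only where h is differentiable. *)
suff dE : 0 < x -> derive1 (objective q lam (- y)) (- x) =
    - derive1 (objective q lam y) x.
  split=> -[/andP[x0 xy]]; rewrite (dE x0); last by move=> ->; rewrite x0 oppr0.
  by move/eqP; rewrite oppr_eq0 => /eqP ->; rewrite x0.
move=> x0; have D := is_derive_objective q lam y x0.
rewrite fE !derive1E.
have D' : is_derive (- (- x)) 1 (objective q lam y)
   (2 * (x - y) + lam * (q * x `^ (q - 1))) by rewrite opprK.
have [_ ->] := is_derive1_comp D' (is_deriveNid (- x) 1).
by have [_ ->] := D; rewrite mulrN1.
Qed.

Lemma largest_criticalN (R : realType) (q lam y x : R) : 0 < y ->
  largest_critical q lam (- y) (- x) <-> largest_critical q lam y x.
Proof.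
move=> y0; rewrite /largest_critical normrN; split=> -[C L]; split.
- exact/critical_pointsN.
- by move=> z /(critical_pointsN _ _ _ y0)/L; rewrite normrN.
- exact/critical_pointsN.
- by move=> z; rewrite -(opprK z) => /(critical_pointsN _ _ _ y0)/L; rewrite !normrN.
Qed.

(** * Large |y|: the critical point beyond the pivot *)

Lemma exists_critical_gt_pivot (R : realType) (q lam y : R) :
  0 < q -> q < 1 -> 0 < lam -> threshold q lam < y ->
  exists x, [/\ pivot q lam < x, x < y &
    2 * x * (x - y) + q * lam * x `^ q = 0].
Proof.
move=> q0 q1 l0 ay; have m0 := pivot_gt0 q1 l0.
have mE := pivot_powR q1 l0; have aE := thresholdE q1 l0.
have a0 := threshold_gt0 q1 l0.
(* Since (2 - q) / (2 (1 - q)) > 1, the pivot lies below the threshold. *)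
have my : pivot q lam < y by nra.
set m := pivot q lam in m0 mE aE my *.
pose f (x : R) := 2 * x * (x - y) + q * lam * x `^ q.
(* The computation amounts to f(m) = 2 m (a - y): the sign at the pivot is decided by the
   threshold. *)
have fm : f m < 0.
  have q1' : 0 < 1 - q by lra.
  rewrite -(pmulr_rlt0 _ q1') /f.
  have -> : (1 - q) * (2 * m * (m - y) + q * lam * m `^ q) =
    2 * (1 - q) * m * (m - y) + q * (lam * (1 - q) * m `^ q) by ring.
  rewrite mE.
  have -> : 2 * (1 - q) * m * (m - y) + q * m ^+ 2 =
    m * ((2 - q) * m - 2 * (1 - q) * y) by ring.
  by rewrite -aE -mulrBr pmulr_rlt0// pmulr_rlt0 ?subr_lt0//; lra.
have fy : 0 < f y.
  by rewrite /f subrr mulr0 add0r !mulr_gt0 ?powR_gt0//; lra.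
have cf : {within `[m, y], continuous f}.
  apply: derivable_within_continuous => x; rewrite in_itv /= => /andP[mx _].
  have x0 : 0 < x by lra.
  have [D _] := is_derive1_powR q x0.
  by apply: derivableD; [exact: derivableM|exact: derivableM].
have [|x] := IVT (v := 0) (ltW my) cf.
  by rewrite min_l ?max_r ?ltW//; exact: lt_trans fy.
rewrite in_itv /= => /andP[mx xy] fx0; exists x; split=> //.
  by rewrite lt_neqAle mx andbT; apply: contraTneq fm => ->; rewrite fx0 ltxx.
by rewrite lt_neqAle xy andbT; apply: contraTneq fy => <-; rewrite fx0 ltxx.
Qed.

Lemma derivative_gt0_past_critical (R : realType) (q lam y x z : R) :
  0 < q -> q < 1 -> 0 < lam -> pivot q lam < x ->
  2 * x * (x - y) + q * lam * x `^ q = 0 -> x < z ->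
  0 < 2 * z * (z - y) + q * lam * z `^ q.
Proof.
move=> q0 q1 l0 mx E xz; have x0 : 0 < x := lt_trans (pivot_gt0 q1 l0) mx.
have S := pivot_lt_powR q1 l0 mx.
have t1 : 1 < z / x by rewrite ltr_pdivlMr// mul1r.
rewrite -(divfK (lt0r_neq0 x0) z); move: (z / x) t1 => t t1.
have t0 : 0 <= t by lra.
rewrite powRM ?(ltW x0)//.
have B := powR_bernoulli q0 q1 t0.
have u0 : 0 < lam * x `^ q by rewrite mulr_gt0 ?powR_gt0.
set u := lam * x `^ q in u0.
(* The critical equation eliminates y. *)
have E' : 2 * x * y = 2 * x ^+ 2 + q * u by rewrite -[RHS]subr0 -E /u; ring.
have S' : (1 - q) * u < x ^+ 2 by move: S; rewrite /u; lra.
have -> : 2 * (t * x) * (t * x - y) + q * lam * (t `^ q * x `^ q) =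
  2 * t ^+ 2 * x ^+ 2 - t * (2 * x * y) + q * u * t `^ q by rewrite /u; ring.
rewrite E'.
have qu : 0 < q * u by exact: mulr_gt0.
have : q * u * ((2 - q) * t - (1 - q) * t ^+ 2) <= q * u * t `^ q.
  by rewrite ler_pM2l//; lra.
(* This product is the lower bound left once Bernoulli's inequality, scaled by q u, replaces t^q. *)
have : 0 < t * (t - 1) * (2 * x ^+ 2 - q * ((1 - q) * u)).
  by rewrite mulr_gt0 ?mulr_gt0//; [lra|lra|nra].
by nra.
Qed.

Lemma critical_minimizer (R : realType) (q lam y x z : R) :
  0 < q -> q < 1 -> 0 < lam -> 0 < y -> pivot q lam < x ->
  2 * x * (x - y) + q * lam * x `^ q = 0 ->
  objective q lam y x <= objective q lam y z.
Proof.
move=> q0 q1 l0 y0 mx E; have x0 : 0 < x := lt_trans (pivot_gt0 q1 l0) mx.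
apply: le_trans (le_objective_norm _ _ _ (ltW y0)).
rewrite /objective normr_id (gtr0_norm x0).
have S := pivot_lt_powR q1 l0 mx.
have t0 : 0 <= `|z| / x by rewrite divr_ge0// ltW.
rewrite -(divfK (lt0r_neq0 x0) `|z|); move: (`|z| / x) t0 => t t0.
rewrite powRM ?(ltW x0)//.
have B := powR_bernoulli q0 q1 t0.
have u0 : 0 < lam * x `^ q by rewrite mulr_gt0 ?powR_gt0.
set u := lam * x `^ q in u0 *.
have E' : 2 * x * y = 2 * x ^+ 2 + q * u by rewrite -[RHS]subr0 -E /u; ring.
have S' : 0 <= x ^+ 2 - (1 - q) * u by move: S; rewrite /u; lra.
rewrite -subr_ge0.
have -> : (y - t * x) ^+ 2 + lam * (t `^ q * x `^ q) - ((y - x) ^+ 2 + u) =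
  x ^+ 2 * (t ^+ 2 - 1) - (2 * x * y) * (t - 1) + u * (t `^ q - 1).
  by rewrite /u; ring.
rewrite E'.
(* The difference h(z) - h(x) is a square with nonnegative coefficient plus u times the gap in
   Bernoulli's inequality. *)
have -> : x ^+ 2 * (t ^+ 2 - 1) - (2 * x ^+ 2 + q * u) * (t - 1) +
    u * (t `^ q - 1) = (x ^+ 2 - (1 - q) * u) * (t - 1) ^+ 2 +
  u * ((1 - q) * t ^+ 2 + t `^ q - (2 - q) * t) by ring.
by rewrite addr_ge0// mulr_ge0 ?sqr_ge0 ?(ltW u0)//; lra.
Qed.

(** * The lower bound on |x'| and the conclusion *)

(** The left side is the zero of h'' on x > 0. The two bases differ by the factor q / 2 < 1. *)
Lemma inflection_lt_pivot (R : realType) (q lam : R) :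
  0 < q -> q < 1 -> 0 < lam ->
  (lam * q * (1 - q) / 2) `^ (1 / (2 - q)) < pivot q lam.
Proof.
move=> q0 q1 l0; have lq0 : 0 < lam * (1 - q) by nra.
have -> : lam * q * (1 - q) / 2 = lam * (1 - q) * (q / 2) by ring.
apply: gt0_ltr_powR; rewrite ?nnegrE.
- by rewrite divr_gt0//; lra.
- by nra.
- exact: ltW.
- by nra.
Qed.

Lemma exists_largest_critical (R : realType) (q lam y : R) :
  0 < q -> q < 1 -> 0 < lam -> threshold q lam < `|y| ->
  exists x, [/\ largest_critical q lam y x,
    forall x', largest_critical q lam y x' -> x' = x,
    pivot q lam < `|x| &
    forall z, objective q lam y x <= objective q lam y z].
Proof.
move=> q0 q1 l0 ay; have a0 := threshold_gt0 q1 l0.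
wlog y0 : y ay / 0 < y => [H|].
  have [y0|y0|y0] := ltgtP 0 y; [exact: H| |by move: ay; rewrite -y0 normr0; lra].
  have y0' : 0 < - y by rewrite oppr_gt0.
  have [||x [L U P M]] := H (- y); rewrite ?normrN//.
  exists (- x); split.
  - by rewrite -[y]opprK; apply/largest_criticalN.
  - move=> x'; rewrite -{1}[y]opprK -{1}[x']opprK.
    by move/(largest_criticalN _ _ _ y0')/U => <-; rewrite opprK.
  - by rewrite normrN.
  - by move=> z; rewrite -objectiveNN opprK -[leRHS]objectiveNN.
rewrite gtr0_norm// in ay.
have [x [mx xy E]] := exists_critical_gt_pivot q0 q1 l0 ay.
have m0 := pivot_gt0 q1 l0; have x0 : 0 < x := lt_trans m0 mx.
have C : critical_points q lam y x.
  by apply/critical_pointsP => //; rewrite x0.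
have L z : critical_points q lam y z -> 0 < z <= x.
  move=> /critical_pointsP[]// /andP[z0 _] Ez; rewrite z0 leNgt.
  apply/negP => /(derivative_gt0_past_critical q0 q1 l0 mx E).
  by rewrite Ez ltxx.
exists x; split.
- by split=> // z /L /andP[z0 zx]; rewrite !gtr0_norm.
(* All critical points are positive here, so equal absolute values mean equal points. *)
- move=> x' [/L/andP[x'0 x'x]] /(_ _ C); rewrite !gtr0_norm// => xx'.
  by apply/le_anti; rewrite x'x.
- by rewrite gtr0_norm.
- by move=> z; exact: critical_minimizer.
Qed.

Theorem lemma3p1 (R : realType) (y q lam : R)
    (hq0 : 0 < q) (hq1 : q < 1) (hlam : 0 < lam) :
  [/\ threshold q lam < `|y| -> exists! x' : R, largest_critical q lam y x',
      forall x : R, objective q lam y (psi_H q lam y) <= objective q lam y x &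
      threshold q lam < `|y| ->
        (lam * q * (1 - q) / 2) `^ (1 / (2 - q)) < `|xprime q lam y| ].
Proof.
(* Uniqueness makes the choice in [xprime] return the constructed point rather than the default
   0. *)
have xE x : largest_critical q lam y x ->
    (forall x', largest_critical q lam y x' -> x' = x) -> xprime q lam y = x.
  by move=> L U; apply: xget_unique.
split.
- move=> /(exists_largest_critical hq0 hq1 hlam)[x [L U _ _]].
  by exists x; split=> // x' /U.
- move=> x; rewrite /psi_H; case: ltP => [|ya].
    by move=> /(exists_largest_critical hq0 hq1 hlam)[x' [/xE L /L -> _ M]].
  exact: objective_le0_threshold.
- move=> /(exists_largest_critical hq0 hq1 hlam)[x [/xE L /L -> mx _]].
  exact: lt_trans (inflection_lt_pivot hq0 hq1 hlam) mx.
Qed.
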